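(* Let $X$ be a real random variable distributed according to an even probability density $f(x) = e^{-\psi(x)}$ on $\mathbb{R}$, where $\psi:\mathbb{R}\to\mathbb{R}$ is convex. Let $q$ be a real-valued function on databases with global sensitivity $\Delta$, let $s > 0$, $\epsilon \ge 0$ and $\delta \ge 0$. Suppose there is $x \in [-\infty,\infty]$ with $$x \le \sup\left\{z \in\mathbb{R} \;\middle|\; \psi\left(\frac{z}{s}\right) - \psi\left(\frac{z-\Delta}{s}\right) \le \epsilon\right\}$$ (the supremum being taken in $[-\infty,\infty]$) such that $$\Pr\left(X > \frac{x-\Delta}{s}\right) \le \delta,$$ where for $x = \infty$ the left-hand side is read as $0$. Then the mechanism that on input a database $d$ returns a variate of $q(d) + sX$ is $(\epsilon,\delta)$-differentially private.
   Context: A database is a (finite) collection of record values from some set $V$. Two databases $d, d'$ are neighboring if one can be obtained from the other by adding one record; $\mathcal{N}$ denotes the set of all (ordered, in either order) pairs $(d,d')$ of neighboring databases. The global sensitivity of a real-valued function $q$ on databases is $\Delta = \max_{(d,d')\in\mathcal{N}} |q(d)-q(d')|$ (assumed to exist as a finite real number). A randomized algorithm $M$ is $(\epsilon,\delta)$-differentially private if for every measurable set $S$ of possible outputs and all $(d,d')\in\mathcal{N}$, $\Pr(M(d)\in S) \le e^{\epsilon}\Pr(M(d')\in S)+\delta$, where the probabilities are over the randomness used in $M$. Here outputs are real numbers and $S$ ranges over measurable subsets of $\mathbb{R}$. *)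

(* Defs.v *)
From HB Require Import structures.
From mathcomp Require Import all_boot all_order all_algebra finmap multiset.
From mathcomp Require Import all_classical all_reals all_analysis.
From mathcomp Require Import measurable_realfun.

Set Implicit Arguments.
Unset Strict Implicit.
Unset Printing Implicit Defensive.

Import Order.TTheory GRing.Theory Num.Theory.
Import numFieldTopology.Exports numFieldNormedType.Exports.

Local Open Scope classical_set_scope.
Local Open Scope ring_scope.

Definition database (V : choiceType) := {mset V}%mset.

(* Symmetric: either database may be the one with the extra record. *)
Definition neighboring (V : choiceType) (d d' : database V) : Prop :=
  exists v : V, d' = (v +` d)%mset \/ d = (v +` d')%mset.

(* Delta is an attained maximum, not merely a supremum; in particular it does
   not exist when there are no neighboring databases (V empty). *)
Definition is_global_sensitivity (R : realType) (V : choiceType)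
    (q : database V -> R) (Delta : R) : Prop :=
  let gaps := [set `|q dd.1 - q dd.2| |
                 dd in [set dd : database V * database V |
                          neighboring dd.1 dd.2]] in
  gaps Delta /\ ubound gaps Delta.

(* A randomized algorithm with real outputs is represented by the law of its
   output on each database: M d S is the probability that M(d) is in S. *)
Definition differentially_private (R : realType) (V : choiceType)
    (eps delta : R) (M : database V -> probability R R) : Prop :=
  forall S : set R, measurable S ->
  forall d d' : database V, neighboring d d' ->
  (M d S <= (expR eps)%:E * M d' S + delta%:E)%E.

Definition has_density (R : realType) (disp : measure_display)
    (T : measurableType disp) (P : probability T R) (X : {RV P >-> R})
    (f : R -> R) : Prop :=
  [/\ measurable_fun [set: R] f, forall t : R, 0 <= f t &
      forall S : set R, measurable S ->
        distribution P X S = (\int[lebesgue_measure]_(t in S) (f t)%:E)%E].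

Definition noise_mechanism (R : realType) (V : choiceType)
    (disp : measure_display) (T : measurableType disp) (P : probability T R)
    (q : database V -> R) (s : R) (X : {RV P >-> R}) (d : database V) :
    probability R R :=
  distribution P (cst (q d) \+ cst s \* (X : {mfun T >-> R})).

(* Main.v *)
(* Write D = Delta / s and c = (q d - q d') / s, so |c| <= D. In the variable
   t of X, the two output laws have densities f t and f (t + c), and it
   suffices to bound the mass of the set where f t > e^eps f (t + c). For
   c >= 0, convexity of psi turns psi (t + D) - psi t <= eps into
   psi (t + c) - psi t <= eps, and makes psi (t + D) - psi t nondecreasing in t,
   so the first inequality holds whenever s (t + D) lies below the supremum of
   the statement, in particular below x. The exceptional set is thus contained
   in the tail t >= (x - Delta) / s, whose mass is at most delta since X has no
   atoms. The case c < 0 follows by the reflection t |-> - t, f being even. *)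
Require Import Defs.
From HB Require Import structures.
From mathcomp Require Import all_boot all_order all_algebra finmap multiset.
From mathcomp Require Import all_classical all_reals all_analysis.
From mathcomp Require Import ring lra measurable_realfun.

Import Order.TTheory GRing.Theory Num.Theory.
Import numFieldTopology.Exports numFieldNormedType.Exports.

Local Open Scope classical_set_scope.
Local Open Scope ring_scope.

Lemma convex_functionP {R : realType} {g : R -> R} :
  @convex_function R R^o [set: R^o] g ->
  forall l a b, 0 <= l <= 1 ->
  g (l * a + (1 - l) * b) <= l * g a + (1 - l) * g b.
Proof.
move=> cvx l a b /andP[l0 l1].
exact: (cvx (Itv01 l0 l1) a b (in_setT _) (in_setT _)).
Qed.

(** Both [b] and [a + D] lie on the segment from [a] to [b + D], with complementary weights [l] and
    [1 - l]; the two convexity inequalities add up to the claim. *)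
Lemma convex_le_increment {R : realType} {g : R -> R} {D a b : R} :
  @convex_function R R^o [set: R^o] g -> 0 <= D -> a <= b ->
  g (a + D) - g a <= g (b + D) - g b.
Proof.
move=> /convex_functionP cvx D0 ab.
(* This segment is a single point only if [D = 0] and [a = b]. *)
have [aE|abD] := eqVneq a (b + D).
  have -> : b = a by lra.
  by [].
have ne0 : b + D - a != 0 by rewrite subr_eq0 eq_sym.
have gt0 : 0 < b + D - a by rewrite lt_neqAle eq_sym ne0 /=; lra.
pose l := D / (b + D - a).
have l01 : 0 <= l <= 1.
  apply/andP; split; first by rewrite divr_ge0// ltW.
  by rewrite ler_pdivrMr// mul1r; lra.
have m01 : 0 <= 1 - l <= 1 by lra.
have := cvx _ a (b + D) l01; have := cvx _ a (b + D) m01.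
have -> : l * a + (1 - l) * (b + D) = b by rewrite /l; field.
have -> : (1 - l) * a + (1 - (1 - l)) * (b + D) = a + D by rewrite /l; field.
lra.
Qed.

(** For [D > 0], the point [a + c] has weight [c / D] on the segment from [a] to [a + D], so its
    increment is at most [c / D * e], hence at most [e] because [0 <= e]. *)
Lemma convex_le_increment_max {R : realType} {g : R -> R} {D c a e : R} :
  @convex_function R R^o [set: R^o] g -> 0 <= c <= D -> 0 <= e ->
  g (a + D) - g a <= e -> g (a + c) - g a <= e.
Proof.
move=> /convex_functionP cvx /andP[c0 cD] e0 gD.
have [D0|D0] := eqVneq D 0.
  by have -> : c = D by lra.
have Dgt0 : 0 < D by rewrite lt_neqAle eq_sym D0 (le_trans c0).
have c01 : 0 <= c / D <= 1.
  apply/andP; split; first by rewrite divr_ge0// ltW.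
  by rewrite ler_pdivrMr// mul1r.
have := cvx _ (a + D) a c01.
have -> : c / D * (a + D) + (1 - c / D) * a = a + c by field.
move: c01; set l := c / D => l01.
nra.
Qed.

(** Lebesgue measure is determined by its values on half-open intervals, whose length a shift
    preserves. *)
Lemma lebesgue_measure_shift {R : realType} (c : R) {A : set R} :
  measurable A ->
  pushforward lebesgue_measure ((fun t => t + c) : R -> measurableTypeR R) A =
  lebesgue_measure A.
Proof.
have mshift : measurable_fun setT ((fun t => t + c) : R -> measurableTypeR R).
  exact: measurable_funD.
move=> mA; apply/esym/lebesgue_measure_unique => //= _ [[a b]] _ <-.
rewrite /pushforward.
have -> : (fun t : R => t + c) @^-1` `]a, b] = `](a - c), (b - c)]%classic.
  by apply/seteqP; split => t /=; rewrite !in_itv/= ltrBlDr lerBrDr.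
rewrite !lebesgue_measure_itv/= !lte_fin ltrD2r.
by case: ifP => // _; rewrite -!EFinB; congr EFin; ring.
Qed.

Section integral_translation_reflection.
Local Open Scope ereal_scope.
Context {R : realType} {f : R -> \bar R} {A : set R}.
Hypotheses (mA : measurable A) (mf : measurable_fun [set: R] f).
Hypothesis f0 : forall t, 0 <= f t.

Lemma integral_shift (c : R) :
  \int[lebesgue_measure]_(t in (fun u => u + c)%R @^-1` A) f t =
  \int[lebesgue_measure]_(t in A) f (t - c)%R.
Proof.
(* Writing the integrand as a composition with the shift prepares the change of variables for a
   pushforward. *)
transitivity (\int[lebesgue_measure]_(t in (fun u => u + c)%R @^-1` A)
    ((fun u => f (u - c)%R) \o (fun u => u + c)%R) t).
  by apply: eq_integral => t _ /=; rewrite addrK.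
have mshift : measurable_fun setT
    ((fun t => t + c)%R : measurableTypeR R -> measurableTypeR R).
  exact: measurable_funD.
rewrite -(ge0_integral_pushforward mshift)//.
  by apply: eq_measure_integral => B mB _; exact: lebesgue_measure_shift.
apply: measurable_funTS; apply: (measurableT_comp mf).
exact: measurable_funB.
Qed.

Lemma integral_reflection :
  \int[lebesgue_measure]_(t in -%R @^-1` A) f (- t)%R =
  \int[lebesgue_measure]_(t in A) f t.
Proof.
have mopp : measurable_fun setT
    (-%R : measurableTypeR R -> measurableTypeR R) by [].
rewrite -(ge0_integral_pushforward mopp)//; last exact: measurable_funTS.
by apply: eq_measure_integral => B mB _; exact: lebesgue_measureN.
Qed.

End integral_translation_reflection.

(** The pointwise bound is integrated over the part of [S] outside [A]; the part inside costs at
    most the whole mass of [A]. *)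
Lemma integral_le_off_set {d : measure_display} {T : measurableType d}
    {R : realType} (mu : {measure set T -> \bar R}) {f g : T -> R} {k : R}
    {S A : set T} :
  measurable S -> measurable A ->
  measurable_fun setT f -> measurable_fun setT g ->
  (forall t, 0 <= f t) -> (forall t, 0 <= g t) -> 0 <= k ->
  (forall t, ~ A t -> f t <= k * g t) ->
  (\int[mu]_(t in S) (f t)%:E <=
   k%:E * \int[mu]_(t in S) (g t)%:E + \int[mu]_(t in A) (f t)%:E)%E.
Proof.
move=> mS mA mf mg f0 g0 k0 fg.
have mSA : measurable (S `&` A) by exact: measurableI.
have mSD : measurable (S `\` A) by exact: measurableD.
have mfE D : measurable_fun D (EFin \o f).
  by apply/measurable_EFinP; exact: measurable_funTS.
have mgE D : measurable_fun D (EFin \o g).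
  by apply/measurable_EFinP; exact: measurable_funTS.
rewrite -{1}(setDUK (@subIsetl _ S A)) setDIr setDv set0U.
rewrite ge0_integral_setU//; last 2 first.
- by move=> t _; rewrite lee_fin.
- by apply/disj_setPS => t [[_ At]] [_ /(_ At)].
rewrite addeC; apply: leeD; last first.
  apply: ge0_subset_integral => // t _; exact: f0.
rewrite -ge0_integralZl//; last by move=> t _; rewrite lee_fin.
apply: (@le_trans _ _ (\int[mu]_(t in S `\` A) (k%:E * (g t)%:E))%E).
  apply: ge0_le_integral => //.
  - by move=> t _; rewrite lee_fin.
  - by apply: measurable_funeM.
  - by move=> t [_ /fg]; rewrite -EFinM lee_fin.
apply: ge0_subset_integral => //.
- by apply: measurable_funeM.
- by move=> t _; rewrite mule_ge0 ?lee_fin.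
Qed.

Theorem lemma2 (R : realType) (disp : measure_display)
    (T : measurableType disp) (P : probability T R) (X : {RV P >-> R})
    (psi f : R -> R)
    (psi_convex : @convex_function R R^o [set: R^o] psi)
    (f_def : forall t : R, f t = expR (- psi t))
    (f_even : forall t : R, f (- t) = f t)
    (X_density : has_density X f)
    (V : choiceType) (q : database V -> R) (Delta : R)
    (Delta_sens : is_global_sensitivity q Delta)
    (s eps delta : R) (s_gt0 : 0 < s) (eps_ge0 : 0 <= eps)
    (delta_ge0 : 0 <= delta)
    (x_exists : exists x : \bar R,
      (x <= ereal_sup
              [set z%:E | z in [set z : R |
                 (psi (z / s) - psi ((z - Delta) / s) <= eps)%R]])%E /\
      (P [set w : T | (x - Delta%:E) * (s^-1)%:E < (X w)%:E] <= delta%:E)%E) :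
  differentially_private eps delta (noise_mechanism q s X).
Proof.
have [mf f_ge0 fX] := X_density.
have [[dd _ DeltaE] Delta_ub] := Delta_sens.
have Delta_ge0 : 0 <= Delta by rewrite -DeltaE.
have [x [x_sup x_tail]] := x_exists.
have s_neq0 : s != 0 by rewrite gt_eqF.
pose D := Delta / s; pose y := ((x - Delta%:E) * (s^-1)%:E)%E.
have D_ge0 : 0 <= D by rewrite divr_ge0// ltW.
(* The weak inequality makes [t < y] strict outside [A], as extracting a witness from the supremum
   requires. Compared with the tail in the hypothesis, [A] gains at most one point, which is
   Lebesgue-null. *)
pose A := [set t : R | (y <= t%:E)%E].
have A_itv : A = [set t : R | (y < t%:E)%E] `|` [set t : R | y = t%:E].
  apply/seteqP; split => t /=; rewrite /A/= le_eqVlt.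
    by case/predU1P => [->|]; [right|left].
  by case=> [->|->]; rewrite ?eqxx ?orbT.
have mlt (z : \bar R) : measurable [set t : R | (z < t%:E)%E].
  case: z => [a| |].
  - rewrite (_ : [set _ | _] = `]a, +oo[%classic)//.
    by apply/seteqP; split => t /=; rewrite in_itv/= andbT lte_fin.
  - by rewrite (_ : [set _ | _] = set0)//; apply/seteqP; split => t.
  - rewrite (_ : [set _ | _] = setT)//.
    by apply/seteqP; split => t//= _; rewrite ltNyr.
have [a eq_sub] : exists a, [set t : R | y = t%:E] `<=` [set a].
  by exists (fine y) => t /= ->.
have meq : measurable [set t : R | y = t%:E].
  by have [->|->] := subset_set1 eq_sub.
have mA : measurable A by rewrite A_itv; exact: measurableU.
have mfE B : measurable_fun B (EFin \o f).
  by apply/measurable_EFinP; exact: measurable_funTS.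
have A_tail : (\int[lebesgue_measure]_(t in A) (f t)%:E <= delta%:E)%E.
  rewrite A_itv ge0_integral_setU//; last 4 first.
  - exact: mlt.
  - exact: mfE.
  - by move=> t _; rewrite lee_fin.
  - by apply/disj_setPS => t [/= /[swap] ->]; rewrite ltxx.
  by rewrite (integral_Sset1 _ eq_sub) adde0 -fX.
have psi_le t : ~ A t -> psi (t + D) - psi t <= eps.
  move/negP; rewrite /A/= -ltNge /y lte_pdivlMr// => tx.
  (* Outside [A], [s * (t + D)] is strictly below [x], so some [z] in the set exceeds it. Then
     [t <= (z - Delta) / s], and monotonicity of increments carries the bound from [(z - Delta) / s]
     down to [t]. *)
  have /ereal_sup_gt[_ [z /= zP <-]] : ((s * (t + D))%:E < ereal_sup
      [set z%:E | z in [set z : R |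
         (psi (z / s) - psi ((z - Delta) / s) <= eps)%R]])%E.
    apply: lt_le_trans x_sup; move: tx; case: (x) => [r|_|].
    - rewrite -!EFinB !lte_fin /D.
      by rewrite mulrDr mulrCA divff// mulr1 mulrC; lra.
    - exact: ltry.
    - by rewrite addNye.
  rewrite lte_fin => zt; apply: le_trans zP.
  have -> : z / s = (z - Delta) / s + D by rewrite /D; field.
  apply: convex_le_increment => //.
  by rewrite ler_pdivlMr//; move: zt; rewrite /D mulrDr mulrCA divff//; lra.
have f_le t c : 0 <= c <= D -> ~ A t -> f t <= expR eps * f (t + c).
  move=> cD /psi_le tD; rewrite !f_def -expRD ler_expR.
  by have := convex_le_increment_max psi_convex cD eps_ge0 tD; lra.
move=> S mS d d' dd'.
pose c := (q d - q d') / s.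
have c_le : `|c| <= D.
  rewrite normrM normfV (gtr0_norm s_gt0) ler_pM2r ?invr_gt0//.
  by apply: Delta_ub; exists (d, d').
pose S' := (fun t => q d + s * t) @^-1` S.
have mS' : measurable S'.
  rewrite -[S']setTI; have : measurable_fun setT (fun t : R => q d + s * t).
    by apply: measurable_funD => //; exact: measurable_funM.
  exact.
have -> : noise_mechanism q s X d S =
    (\int[lebesgue_measure]_(t in S') (f t)%:E)%E by rewrite -fX.
have -> : noise_mechanism q s X d' S =
    (\int[lebesgue_measure]_(t in S') (f (t + c))%:E)%E.
  (* Since [q d' + s * X = q d + s * (X - c)], the second output lies in [S] exactly when [X - c]
     lies in [S']. *)
  under eq_integral do rewrite -[c]opprK.
  rewrite -(integral_shift (f := EFin \o f) mS' (mfE _)); last first.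
    by move=> t /=; rewrite lee_fin.
  rewrite -fX; last first.
    by rewrite -[_ @^-1` _]setTI; exact: measurable_funD.
  rewrite /noise_mechanism /distribution /pushforward; congr (P _).
  apply/funext => w; rewrite /S' /preimage/=; congr (S _).
  by rewrite /c; field.
have mfc : measurable_fun setT (fun t : R => f (t + c)).
  by apply: (measurableT_comp mf); exact: measurable_funD.
have [c_ge0|c_lt0] := leP 0 c.
  apply: (le_trans (integral_le_off_set lebesgue_measure mS' mA mf mfc
    f_ge0 (fun=> f_ge0 _) (expR_ge0 eps) _)).
    by move=> t; apply: f_le; rewrite c_ge0 -(ger0_norm c_ge0).
  exact: leeD2l.
(* For [c < 0] the exceptional set is the mirror image of [A]: evenness turns the comparison at [t]
   with shift [c] into the one at [- t] with shift [- c], and gives both sets the same mass. *)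
have mNA : measurable (-%R @^-1` A).
  rewrite -[_ @^-1` _]setTI; have : measurable_fun setT (-%R : R -> R) by [].
  exact.
apply: (le_trans (integral_le_off_set lebesgue_measure mS' mNA mf mfc
    f_ge0 (fun=> f_ge0 _) (expR_ge0 eps) _)).
  move=> t /f_le At; rewrite -f_even -(f_even (t + c)) opprD.
  by apply: At; rewrite -(ltr0_norm c_lt0) normr_ge0.
apply: leeD2l.
under eq_integral do rewrite -f_even.
by rewrite (integral_reflection mA (f := EFin \o f)).
Qed.
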